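(* A conditional lower prevision $\underline{P}:\mathcal{D}_{LIN}\rightarrow\mathbb{R}$ is $2$-convex on $\mathcal{D}_{LIN}$ if and only if both of the following axioms hold: (A1) $\underline{P}(X|B)-\underline{P}(Y|B)\leq\sup\{X-Y|B\}$ for all $X|B,\,Y|B\in\mathcal{D}_{LIN}$; (A4) $\underline{P}(A(X-\underline{P}(X|A\wedge B))|B)=0$ for all $X\in\mathcal{X}$ and all $A,B\in\mathcal{B}^{\varnothing}$ with $A\wedge B\neq\varnothing$.
   Context: Fix a partition $\mathbb{P}$ of the sure event $\Omega$ into atoms $\omega$. A gamble is a bounded function $X:\mathbb{P}\to\mathbb{R}$. Events are subsets of $\mathbb{P}$ and are identified with their indicator functions; $\wedge,\vee,\neg$ denote intersection, union, complement; $\varnothing$ is the impossible event. For a gamble $X$ and an event $B\neq\varnothing$, the conditional gamble $X|B$ is the restriction of $X$ to $B$; thus $\sup(X|B)=\sup\{X|B\}=\sup_{\omega\in B}X(\omega)$, and similarly for $\inf$. A conditional lower prevision on a set $\mathcal{D}$ of conditional gambles is a map $\underline{P}:\mathcal{D}\to\mathbb{R}$. Let $\mathcal{X}$ be a linear space of gambles and $\mathcal{B}\subset\mathcal{X}$ a set of (indicators of) events in $\mathcal{X}$, with $\Omega\in\mathcal{B}$ and $BX\in\mathcal{X}$ for all $B\in\mathcal{B}$, $X\in\mathcal{X}$. Put $\mathcal{B}^{\varnothing}=\mathcal{B}\setminus\{\varnothing\}$ and $\mathcal{D}_{LIN}=\{X|B: X\in\mathcal{X}, B\in\mathcal{B}^{\varnothing}\}$.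 $\underline{P}:\mathcal{D}\to\mathbb{R}$ is $2$-convex on $\mathcal{D}$ iff for all $X_0|B_0,X_1|B_1\in\mathcal{D}$, setting $\underline{G}_{2c}=B_1(X_1-\underline{P}(X_1|B_1))-B_0(X_0-\underline{P}(X_0|B_0))$, one has $\sup(\underline{G}_{2c}|B_0\vee B_1)\geq 0$.
   Formalization: The set of events B is additionally assumed closed under intersection (so that P(X|A∧B) is defined) and under union; for an arbitrary set of events the equivalence fails. Both hold if B consists of all events in X. *)

(* Defs.v *)
From mathcomp Require Import all_boot all_order all_algebra.
From mathcomp Require Import all_classical all_reals all_analysis.

Set Implicit Arguments.
Unset Strict Implicit.
Unset Printing Implicit Defensive.
Import Order.TTheory GRing.Theory Num.Theory.
Import numFieldNormedType.Exports.
Local Open Scope classical_set_scope.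
Local Open Scope ring_scope.

(* [T] is the partition of the sure event: its elements are the atoms and the
   events are the sets of atoms. *)

Definition gamble {T : Type} {R : realType} (X : T -> R) : Prop := bounded_fun X.

(* An event together with a function on that event.  X|B and Y|B are thus the
   same object as soon as X and Y agree on B, whereas X|A and X|B differ when
   A and B do. *)
Definition cgamble (T : Type) (R : realType) := {B : set T & B -> R}.

Definition restr {T : Type} {R : realType} (X : T -> R) (B : set T) :
    cgamble T R :=
  existT (fun B : set T => B -> R) B (fun w : B => X (set_val w)).

Notation "X '`|_' B" := (restr X B)
  (at level 50, B at level 0, left associativity).

(* sup(X|B).  [sup] is the real supremum, which is meaningful only for nonempty
   sets that are bounded above: X must be bounded above on B and B nonempty. *)
Definition csup {T : Type} {R : realType} (X : T -> R) (B : set T) : R :=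
  sup (X @` B).

Section LowerPrevisions.
Context {T : Type} {R : realType}.
Implicit Types (XX : set (T -> R)) (BB : set (set T)).

(* [XX] is the linear space of gambles and [BB] the set of conditioning events.
   Closure of [BB] under intersection ensures that X|(A /\ B), which occurs in
   [axiomA4], belongs to the domain; closure under union is what makes
   B0 \/ B1, on which 2-convexity takes its supremum, a conditioning event.
   Both closures hold automatically when [BB] consists of all the events whose
   indicators are in [XX], and neither follows from the other conditions for an
   arbitrary [BB]. *)
Record lin_framework XX BB : Prop := LinFramework {
  lin_gamble : XX `<=` gamble;
  lin_submod : submod_closed (mem XX);
  lin_indic : forall B, BB B -> XX \1_B;
  lin_setT : BB setT;
  lin_mul : forall B X, BB B -> XX X -> XX (\1_B * X);
  lin_setI : setI_closed BB;
  lin_setU : setU_closed BB }.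

Definition nonempty_events BB : set (set T) := BB `\ set0.

Definition D_LIN XX BB : set (cgamble T R) :=
  [set c | exists X B, [/\ XX X, nonempty_events BB B & c = X `|_ B]].

(* Conditional lower previsions are total functions on [cgamble T R]; only
   their values on the domain [D] are ever used.  In the gain, X_i matters only
   through its values on B_i, so ranging over all representatives X_i of a
   conditional gamble of [D] is the same as ranging over [D]. *)
Definition two_convex (D : set (cgamble T R)) (P : cgamble T R -> R) : Prop :=
  forall (X0 X1 : T -> R) (B0 B1 : set T), D (X0 `|_ B0) -> D (X1 `|_ B1) ->
    0 <= csup (\1_B1 * (X1 - cst (P (X1 `|_ B1)))
               - \1_B0 * (X0 - cst (P (X0 `|_ B0)))) (B0 `|` B1).

Definition axiomA1 (D : set (cgamble T R)) (P : cgamble T R -> R) : Prop :=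
  forall (X Y : T -> R) (B : set T), D (X `|_ B) -> D (Y `|_ B) ->
    P (X `|_ B) - P (Y `|_ B) <= csup (X - Y) B.

Definition axiomA4 XX BB (P : cgamble T R -> R) : Prop :=
  forall (X : T -> R) (A B : set T), XX X ->
    nonempty_events BB A -> nonempty_events BB B -> A `&` B <> set0 ->
    P ((\1_A * (X - cst (P (X `|_ (A `&` B))))) `|_ B) = 0.

End LowerPrevisions.

(* Main.v *)
Require Import Defs.
From mathcomp Require Import all_boot all_order all_algebra.
From mathcomp Require Import all_classical all_reals all_analysis.
From mathcomp Require Import lra.

(** Two-convexity applied to two gambles on the same event is A1.  Applied, in
    both orders, to [X|A /\ B] and [A(X - P(X|A /\ B))|B], it gives A4, since
    the gain is then constant on [B].  Conversely, A4 on [B0 \/ B1] writes the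
    two terms of a gain as gambles on [B0 \/ B1] of lower prevision 0, and A1
    then bounds the supremum of their difference from below by 0. *)

Set Implicit Arguments.
Unset Strict Implicit.
Unset Printing Implicit Defensive.
Import Order.TTheory GRing.Theory Num.Theory.
Local Open Scope classical_set_scope.
Local Open Scope ring_scope.

Section ConditionalGambles.
Context {T : Type} {R : realType}.
Implicit Types (X Y : T -> R) (B : set T).

Lemma eq_restr X Y B : {in B, X =1 Y} -> restr X B = restr Y B.
Proof.
move=> eqXY; congr existT; apply/funext => w.
exact/eqXY/valP.
Qed.

Lemma restr_inj X Y B : restr X B = restr Y B -> {in B, X =1 Y}.
Proof.
by move=> eqXY w Bw; have := congr1 (@^~ (SigSub Bw)) (existT_inj2 eqXY).
Qed.

Lemma eq_csup X Y B : {in B, X =1 Y} -> csup X B = csup Y B.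
Proof.
move=> eqXY; congr sup; apply/eq_imagel => w Bw.
by apply: eqXY; rewrite inE.
Qed.

Lemma csup_cst (c : R) B : B !=set0 -> csup (cst c) B = c.
Proof. by move=> /set0P /negPf B0; rewrite /csup set_cst B0 sup1. Qed.

(** The real [sup] dominates its set only when that set is bounded above; boundedness of both
    gambles supplies this. *)
Lemma csup_subl X Y B w : gamble X -> gamble Y -> B w ->
  X w - Y w <= csup (X - Y) B.
Proof.
move=> [M [_ /(_ (M + 1)) bX]] [N [_ /(_ (N + 1)) bY]] Bw.
apply: (ub_le_sup _ (imageP (X - Y) Bw)).
(* [bounded_fun] gives a bound by every real strictly above [M] (resp. [N]), hence the added 1. *)
exists (M + 1 + (N + 1)) => _ [v _ <-].
rewrite (le_trans (ler_norm _))// (le_trans (ler_normB _ _))// lerD//.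
  by apply: bX => //; rewrite ltrDl.
by apply: bY => //; rewrite ltrDl.
Qed.

Lemma eq_indic_mul X Y B : {in B, X =1 Y} -> \1_B * X = \1_B * Y.
Proof.
move=> eqXY; apply/funext => w; rewrite !fctE indicE.
by have [/eqXY->|] := boolP (w \in B); rewrite ?mul0r.
Qed.

(** The right-hand side has the shape [a *: u + v] under which [submod_closed] applies. *)
Lemma indic_mulB_cst X B (c : R) :
  \1_B * (X - cst c) = (- c) *: (\1_B : T -> R) + (\1_B * X : T -> R).
Proof.
by apply/funext => w; rewrite !fctE /GRing.scale/= mulrBr mulNr
  [c * _]mulrC addrC.
Qed.

End ConditionalGambles.

Section LinearFramework.
Context {T : Type} {R : realType} (XX : set (T -> R)) (BB : set (set T)).
Hypothesis lin : lin_framework XX BB.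

(** Off [B], a representative of a conditional gamble of the domain may leave [XX] and even be
    unbounded; this trades it for one in [XX]. *)
Lemma D_LIN_restr X B : D_LIN XX BB (restr X B) <->
  nonempty_events BB B /\ exists2 X', XX X' & {in B, X =1 X'}.
Proof.
split=> [[X' [B' [XX' BB' eqXX']]]|[BBB [X' XX' /eq_restr eqX]]]; last first.
  by exists X', B.
have eqB : B = B' := congr1 (@projT1 _ _) eqXX'.
by subst B'; split=> //; exists X' => //; apply: restr_inj.
Qed.

Lemma lin_indic_mulB X B (c : R) : BB B -> XX X -> XX (\1_B * (X - cst c)).
Proof.
move=> BBB XXX; rewrite indic_mulB_cst.
have [_ /(_ (- c) \1_B (\1_B * X))] := lin_submod lin.
rewrite !inE; apply; first exact: (lin_indic lin).
exact: (lin_mul lin).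
Qed.

Variable P : cgamble T R -> R.

Lemma two_convex_axiomA1 :
  two_convex (D_LIN XX BB) P -> axiomA1 (D_LIN XX BB) P.
Proof.
move=> cvx X Y B DX DY.
have := cvx _ _ _ _ DY DX; rewrite setUid.
have [[_ /eqP/set0P B0] [X' /(lin_gamble lin) gX eqX]] := (D_LIN_restr X B).1 DX.
have [_ [Y' /(lin_gamble lin) gY eqY]] := (D_LIN_restr Y B).1 DY.
have -> : csup (X - Y) B = csup (X' - Y') B.
  by apply: eq_csup => w Bw; rewrite !fctE eqX// eqY.
(* On [B] the gain is [X - Y] shifted by the constant [P (restr Y B) - P (restr X B)], so it
   suffices to bound it pointwise. *)
move=> /le_trans le0; rewrite -subr_ge0 le0//.
apply: ge_sup; first exact: image_nonempty.
move=> _ [w Bw <-]; have Bw' : w \in B by rewrite inE.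
have := csup_subl gX gY Bw.
rewrite !fctE indicE Bw' eqX// eqY//=; lra.
Qed.

Lemma two_convex_axiomA4 : two_convex (D_LIN XX BB) P -> axiomA4 XX BB P.
Proof.
move=> cvx X A B XXX [BA A0] [BBB B0] AB0.
set c := P (restr X (A `&` B)); set Z := \1_A * _; set p := P _.
have DX : D_LIN XX BB (restr X (A `&` B)).
  by exists X, (A `&` B); split=> //; split=> //; apply: (lin_setI lin).
have DZ : D_LIN XX BB (restr Z B).
  by exists Z, B; split=> //; apply: lin_indic_mulB.
(* On [B] the indicators of [A] and of its intersection with [B] agree, so the first term equals [Z]
   and only the price [p] survives. *)
have gain w : w \in B ->
    (\1_(A `&` B) * (X - cst c)) w - (\1_B * (Z - cst p)) w = p.
  move=> Bw; rewrite !fctE !indicE in_setI Bw andbT mul1r.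
  by rewrite opprB addrCA subrr addr0.
have Bn0 : B !=set0 by exact/set0P/eqP.
apply/eqP; rewrite eq_le; apply/andP; split.
  (* In this order the gain is [- p] on [B], so [p <= 0]; the swapped order gives [0 <= p]. *)
  have := cvx _ _ _ _ DX DZ; rewrite (setUidr (@subIsetr _ A B)).
  rewrite (@eq_csup _ _ _ (cst (- p))) ?csup_cst ?oppr_ge0// => w /gain gw.
  by rewrite -[in RHS]gw opprB.
have := cvx _ _ _ _ DZ DX; rewrite (setUidl (@subIsetr _ A B)).
by rewrite (@eq_csup _ _ _ (cst p)) ?csup_cst.
Qed.

Lemma axiomA1_A4_two_convex : axiomA1 (D_LIN XX BB) P -> axiomA4 XX BB P ->
  two_convex (D_LIN XX BB) P.
Proof.
move=> A1 A4 X0 X1 B0 B1 /D_LIN_restr[NB0 [Y0 XY0 eq0]].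
move=> /D_LIN_restr[NB1 [Y1 XY1 eq1]].
have NB : nonempty_events BB (B0 `|` B1).
  case: NB0 NB1 => BB0 n0 [BB1 _]; split; first exact: (lin_setU lin).
  by rewrite /= setU_eq0 => -[].
rewrite (eq_restr eq0) (eq_restr eq1).
set c0 := P (restr Y0 B0); set c1 := P (restr Y1 B1).
rewrite (@eq_indic_mul _ _ _ (Y0 - cst c0) B0); last first.
  by move=> w /eq0 eqw; rewrite !fctE eqw.
rewrite (@eq_indic_mul _ _ _ (Y1 - cst c1) B1); last first.
  by move=> w /eq1 eqw; rewrite !fctE eqw.
(* A4 with [A := B0] and [B] the union: their intersection is [B0], so the price inside is exactly
   [c0]. *)
have P0 : P (restr (\1_B0 * (Y0 - cst c0)) (B0 `|` B1)) = 0.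
  have := A4 Y0 _ _ XY0 NB0 NB; rewrite (setIidl (@subsetUl _ _ _)); apply;
    exact: NB0.2.
have P1 : P (restr (\1_B1 * (Y1 - cst c1)) (B0 `|` B1)) = 0.
  have := A4 Y1 _ _ XY1 NB1 NB; rewrite (setIidl (@subsetUr _ _ _)); apply;
    exact: NB1.2.
(* The bound 0 is rewritten as the difference of the two null previsions, which is the left side of
   A1. *)
rewrite -(subr0 0) -{1}P1 -P0; apply: A1.
  by exists (\1_B1 * (Y1 - cst c1)), (B0 `|` B1); split=> //;
    exact: (lin_indic_mulB c1 NB1.1 XY1).
by exists (\1_B0 * (Y0 - cst c0)), (B0 `|` B1); split=> //;
    exact: (lin_indic_mulB c0 NB0.1 XY0).
Qed.

End LinearFramework.

Theorem proposition2 (T : Type) (R : realType)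
    (XX : set (T -> R)) (BB : set (set T)) (P : cgamble T R -> R) :
  lin_framework XX BB ->
  (two_convex (D_LIN XX BB) P <->
   axiomA1 (D_LIN XX BB) P /\ axiomA4 XX BB P).
Proof.
move=> lin; split=> [cvx|[A1 A4]]; last exact: axiomA1_A4_two_convex.
by split; [exact: two_convex_axiomA1|exact: two_convex_axiomA4].
Qed.
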